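(* Let $(\alpha^*,\pi^* )$ be the true parameter of the stochastic block model and assume (A1), (A2), (A3) (see context) hold for $(\alpha^*,\pi^* )$ and all parameters considered. Let $$(\widetilde\alpha,\widetilde\pi)=\operatorname{argmax}_{\alpha,\pi}J_n(\alpha,\pi),\qquad J_n(\alpha,\pi)=\frac{1}{n(n-1)}\max_{\tau_{[n]}\in\mathcal{S}_n}\mathcal{J}(X_{[n]};\tau_{[n]},\alpha,\pi),$$ be the variational estimators of $(\alpha^*,\pi^* )$ (see context), the maximum being over parameters satisfying (A1), (A2), (A3). Then for any distance $d$ on the set of parameters $\pi$ (considered up to label switching, see context), $$d(\widetilde\pi,\pi^* )\xrightarrow[n\to+\infty]{\mathbb{P}}0 .$$
   Context: Stochastic block model (SBM): $Q$ is fixed and known. With parameters $(\alpha,\pi)$, where $\alpha$ is a probability vector in $(0,1)^Q$ and $\pi\in[0,1]^{Q\times Q}$, the labels $Z=(Z_i)_{i\geq1}$ are i.i.d. with $\mathbb{P}(Z_i=q)=\alpha_q$; given $Z$, the $X_{i,j}$, $i\neq j$, are independent Bernoulli$(\pi_{Z_i,Z_j})$, and $X_{i,i}=0$. $X_{[n]}=(X_{i,j})_{1\leq i,j\leq n}$. $\mathbb{P}$ is the law under $(\alpha^*,\pi^* )$ and $\xrightarrow{\mathbb{P}}$ is convergence in probability. Variational log-likelihood: $\mathcal{S}_n$ is the set of $\tau_{[n]}=(\tau_{i,q})_{1\leq i\leq n,1\leq q\leq Q}$ with $\tau_{i,q}\in[0,1]$ and $\sum_q\tau_{i,q}=1$ for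 every $i$, and $$\mathcal{J}(X_{[n]};\tau_{[n]},\alpha,\pi)=\sum_{i\neq j}\sum_{q,l}[X_{i,j}\log\pi_{q,l}+(1-X_{i,j})\log(1-\pi_{q,l})]\tau_{i,q}\tau_{j,l}-\sum_{i,q}\tau_{i,q}(\log\tau_{i,q}-\log\alpha_q)$$ (equal to the log-likelihood of $(\alpha,\pi)$ minus the Kullback–Leibler divergence from the product distribution $\prod_i\tau_{i,\cdot}$ to the posterior distribution of the labels). Conventions: $0\log0=0$, $0\cdot(-\infty)=0$, $\log0=-\infty$. A maximizer $(\widetilde\alpha,\widetilde\pi)$ is assumed to exist. Distance up to label switching: $d(\pi,\pi^* )=\min_\sigma d_0(\pi^\sigma,\pi^* )$, minimum over permutations $\sigma$ of $\{1,\ldots,Q\}$, with $\pi^\sigma_{q,l}=\pi_{\sigma(q),\sigma(l)}$ and $d_0$ a distance on $\mathbb{R}^{Q\times Q}$ inducing the usual topology. (A1) for every $q\neq q'$ there is $l$ with $\pi_{q,l}\neq\pi_{q',l}$ or $\pi_{l,q}\neq\pi_{l,q'}$. (A2) for all $(q,l)$, $\pi_{q,l}\in(0,1)$ implies $\pi_{q,l}\in[\zeta,1-\zeta]$, with $\zeta>0$ a fixed constant not depending on $n$. (A3) $\alpha_q\in[\gamma,1-\gamma]$ for all $q$, with $0<\gamma<1/Q$ a fixed constant not depending on $n$. *)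

(* Defs.v *)
From HB Require Import structures.
From mathcomp Require Export all_boot all_order all_algebra all_fingroup.
From mathcomp Require Export all_classical all_reals all_analysis.
Export Order.TTheory GRing.Theory Num.Theory.
Export numFieldNormedType.Exports.

Set Implicit Arguments.
Unset Strict Implicit.
Unset Printing Implicit Defensive.

Local Open Scope classical_set_scope.
Local Open Scope ring_scope.

(* A parameter of the model with Q classes is a pair (a, p) : 'rV[R]_Q * 'M[R]_Q,
   where a 0 q = alpha_q and p q l = pi_{q,l}. Nodes and classes are numbered
   from 0. *)

Section SbmParam.
Variables (R : realType) (Q : nat).
Implicit Types (a : 'rV[R]_Q) (p : 'M[R]_Q).

Definition sbm_param a p : Prop :=
  [/\ forall q, 0 < a 0 q < 1,
      \sum_q a 0 q = 1 &
      forall q l, 0 <= p q l <= 1].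

Definition A1 p : Prop :=
  forall q q' : 'I_Q, q != q' ->
    exists l, p q l <> p q' l \/ p l q <> p l q'.

Definition A2 (zeta : R) p : Prop :=
  forall q l, 0 < p q l < 1 -> zeta <= p q l <= 1 - zeta.

Definition A3 (gamma : R) a : Prop :=
  forall q, gamma <= a 0 q <= 1 - gamma.

Definition admissible (zeta gamma : R) a p : Prop :=
  [/\ sbm_param a p, A1 p, A2 zeta p & A3 gamma a].

(* d0 is a distance on Q x Q matrices whose balls generate the usual topology. *)
Definition usual_distance (d0 : 'M[R]_Q -> 'M[R]_Q -> R) : Prop :=
  [/\ forall p p', (d0 p p' = 0) <-> (p = p'),
      forall p p', d0 p p' = d0 p' p,
      forall p p' p'', d0 p p'' <= d0 p p' + d0 p' p'' &
      forall p (A : set 'M[R]_Q),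
        nbhs p A <-> exists2 e : R, 0 < e & forall p', d0 p p' < e -> A p'].

Definition relabel (s : 'S_Q) p : 'M[R]_Q := \matrix_(q, l) p (s q) (s l).

(* The default value of the iterated minimum is its term at s = 1. *)
Definition switch_dist (d0 : 'M[R]_Q -> 'M[R]_Q -> R) p p' : R :=
  \big[Num.min/d0 p p']_(s : 'S_Q) d0 (relabel s p) p'.

End SbmParam.

Section Model.
Context {d : measure_display} {T : measurableType d} {R : realType}.
Variables (P : probability T R) (Q : nat).
Variables (Z : nat -> T -> 'I_Q) (X : nat -> nat -> T -> bool).

(* The labels are random variables for the discrete sigma-algebra on 'I_Q,
   mutually independent, with common law a. *)
Definition iid_labels (a : 'rV[R]_Q) : Prop :=
  [/\ forall i (A : set 'I_Q), measurable (Z i @^-1` A),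
      forall i q, P (Z i @^-1` [set q]) = (a 0 q)%:E &
      forall (s : seq nat) (A : nat -> set 'I_Q), uniq s ->
        P (\bigcap_(i in [set` s]) (Z i @^-1` A i)) =
        (\prod_(i <- s) P (Z i @^-1` A i))%E].

Definition labels_are (n : nat) (z : 'I_n -> 'I_Q) : set T :=
  [set w | forall i : 'I_n, Z i w = z i].

Definition edges_are (n : nat) (x : 'M[bool]_n) : set T :=
  [set w | forall i j : 'I_n, i != j -> X i j w = x i j].

(* Given the labels, the off-diagonal X i j are independent Bernoulli variables
   with parameters p (Z i) (Z j). The conditional law of X_[n] only involves the
   first n labels, which take finitely many values, so it is enough to describe
   it, for every n, on each event labels_are z. *)
Definition bernoulli_edges_given_labels (p : 'M[R]_Q) : Prop :=
  forall n (z : 'I_n -> 'I_Q) (x : 'M[bool]_n),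
    P (labels_are z `&` edges_are x) =
    (P (labels_are z) *
     (\prod_(i < n) \prod_(j < n | j != i)
        bernoulli_pmf (p (z i) (z j)) (x i j))%:E)%E.

Definition is_sbm (a : 'rV[R]_Q) (p : 'M[R]_Q) : Prop :=
  [/\ iid_labels a,
      forall i j, measurable_fun [set: T] (X i j),
      forall i w, X i i w = false &
      bernoulli_edges_given_labels p].

Definition adjacency (n : nat) (w : T) : 'M[bool]_n := \matrix_(i, j) X i j w.

Definition cvg_in_probability (Y : nat -> T -> R) (Y0 : T -> R) : Prop :=
  forall e : R, 0 < e ->
    P [set w | e <= `|Y n w - Y0 w|] @[n --> \oo] --> (0 : \bar R)%E.

End Model.

Section Variational.
Variables (R : realType) (Q n : nat).
Implicit Types (x : 'M[bool]_n) (t : 'M[R]_(n, Q)).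
Implicit Types (a : 'rV[R]_Q) (p : 'M[R]_Q).

Definition variational_set : set 'M[R]_(n, Q) :=
  [set t | (forall i q, 0 <= t i q <= 1) /\ (forall i, \sum_q t i q = 1)].

(* In \bar R, lne 0 = -oo and 0 * -oo = 0, so that 0 log 0 = 0 as well. For
   admissible parameters every term is < +oo. *)
Definition variational_loglik x t a p : \bar R :=
  (\sum_(i < n) \sum_(j < n | j != i) \sum_(q < Q) \sum_(l < Q)
     (((x i j)%:R%:E * lne (p q l)%:E
       + (1 - (x i j)%:R)%:E * lne (1 - p q l)%:E)
      * (t i q * t j l)%:E)
   - \sum_(i < n) \sum_(q < Q)
       (t i q)%:E * (lne (t i q)%:E - lne (a 0 q)%:E))%E.

(* The supremum is a maximum: the objective is upper semicontinuous in t and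
   variational_set is compact. For n < 2 the normalizing factor is 0. *)
Definition Jn x a p : \bar R :=
  ((n * n.-1)%:R^-1%:E *
   ereal_sup [set variational_loglik x t a p | t in variational_set])%E.

Definition is_variational_argmax (zeta gamma : R) x a p : Prop :=
  admissible zeta gamma a p /\
  forall a' p', admissible zeta gamma a' p' -> (Jn x a' p' <= Jn x a p)%E.

End Variational.

(* Main.v *)
Require Import Defs.
From mathcomp Require Import ring lra.

(** The variational objective is dominated by its pair likelihood, a sum over
    [n ^ 2] pairs; entropy and class proportions contribute only [O(n)]. Given
    the labels [z], the pair likelihood is affine in the edges, and its
    conditional mean at weights [t] and parameter [p] is, by the Gibbs
    inequality, at most the mean at the true labels and parameter. The deficit
    is at least a multiple of the mismatch

      [sum_(i, j, q, l) (ps (z i) (z j) - p q l) ^ 2 * (t i q * t j l)]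

    (lemma [pair_loglik_excess]). A maximizer cannot do worse than the true
    parameter, so its mismatch is bounded by the fluctuations of the likelihood
    around its mean, uniformly in [t] and [p] (lemma [mismatch_le]).

    These fluctuations are a combination of bilinear forms [u^T e v], with [e]
    the centred edge matrix and [u], [v] columns of [t], hence with entries in
    the unit interval. By Cauchy-Schwarz used twice, the fourth power of such a
    form is at most [n ^ 4] times the squared Frobenius norm of [e e^T]
    (lemma [bilinear_pow4_le]), whose mean is at most [2 n ^ 3] by independence
    (lemma [gram_energy_mean]). So all these forms are [o(n ^ 2)] at once, with
    high probability, by Markov's inequality.

    A candidate parameter may contain zeros and ones, where the log-likelihood
    is infinite. Adding [eta] to both probabilities of an edge bounds the
    likelihood of the candidate from above by a bounded one, and costs only
    [O(eta)] in the Gibbs inequality (lemma [score_gap]).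

    Finally, when every true class has a proportion bounded below, a small
    mismatch forces each true class [k] to overlap much with some class [s k],
    and then [p (s k) (s k')] to be close to [ps k k']; identifiability (A1) of
    the true parameter makes [s] injective, hence a relabelling
    (lemmas [class_map_of_mismatch] and [relabel_of_class_map]). *)

Set Implicit Arguments.
Unset Strict Implicit.
Unset Printing Implicit Defensive.

Local Open Scope classical_set_scope.
Local Open Scope ring_scope.

(** * A quantitative Gibbs inequality for smoothed logarithms *)

Section RealInequalities.
Variable R : realType.
Implicit Types a b p eta x : R.

Lemma ln_le_sub1 x : 0 < x -> ln x <= x - 1.
Proof.
by move=> x0; have := @le_ln1Dx R (x - 1); rewrite (_ : 1 + (x - 1) = x); [apply; lra | ring].
Qed.

(** Summed over the atoms of two distributions, this bounds the Kullback-Leibler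
divergence below by the squared Hellinger distance. It comes from
[ln u <= u - 1] at [u = Num.sqrt (b / a)] rather than at [b / a], which is what
leaves a square behind. *)
Lemma mul_ln_le a b : 0 <= a -> 0 < b ->
  a * ln b <= a * ln a + b - a - (Num.sqrt a - Num.sqrt b) ^+ 2.
Proof.
move=> a0 b0; set s := Num.sqrt a; set r := Num.sqrt b.
have ra : s ^+ 2 = a by rewrite sqr_sqrtr.
have rb : r ^+ 2 = b by rewrite sqr_sqrtr // ltW.
have r0 : 0 < r by rewrite sqrtr_gt0.
move: a0; rewrite le_eqVlt => /predU1P[a0|a0].
  have s0 : s = 0 by rewrite /s -a0 sqrtr0.
  by rewrite -a0 s0 -rb; lra.
have s0 : 0 < s by rewrite sqrtr_gt0.
have lnq : ln r - ln s <= r / s - 1.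
  by rewrite -ln_div ?posrE // ln_le_sub1 // divr_gt0.
have : s ^+ 2 * (ln r - ln s) *+ 2 <= s ^+ 2 * (r / s - 1) *+ 2.
  by rewrite lerMn2r /= ler_wpM2l // sqr_ge0.
have -> : s ^+ 2 * (r / s - 1) = s * r - s ^+ 2 by field; rewrite gt_eqF.
have la : ln a = ln s *+ 2 by rewrite -ra lnXn.
have lb : ln b = ln r *+ 2 by rewrite -rb lnXn.
by rewrite la lb -ra -rb; lra.
Qed.

Lemma sqr_sub_le_sqrt a b : 0 <= a <= 2 -> 0 <= b <= 2 ->
  (a - b) ^+ 2 / 8 <= (Num.sqrt a - Num.sqrt b) ^+ 2.
Proof.
move=> /andP[a0 a2] /andP[b0 b2]; set s := Num.sqrt a; set r := Num.sqrt b.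
have ra : s ^+ 2 = a by rewrite sqr_sqrtr.
have rb : r ^+ 2 = b by rewrite sqr_sqrtr.
have -> : (a - b) ^+ 2 = (s - r) ^+ 2 * (s + r) ^+ 2 by rewrite -ra -rb; ring.
rewrite ler_pdivrMr // ler_wpM2l ?sqr_ge0 //.
have := sqr_ge0 (s - r); lra.
Qed.

(** The log-likelihood of one edge, with both probabilities shifted by [eta].
At [eta = 0] it is the true one, up to [ln 0 = 0] instead of minus infinity.
For [eta > 0] it dominates the true one in the extended reals, and for [x] and
[p] in the unit interval it is bounded in terms of [eta] alone. *)
Definition score eta x p : R := x * ln (p + eta) + (1 - x) * ln (1 - p + eta).

(** Shifting adds total mass [2 * eta] to the candidate distribution, so the Gibbs
inequality survives up to a multiple of [eta]. *)
Lemma score_gap a p eta : 0 <= a <= 1 -> 0 <= p <= 1 -> 0 < eta <= 1 ->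
  score eta a p <= score 0 a a + 3 * eta - (a - p) ^+ 2 / 16.
Proof.
move=> /andP[a0 a1] /andP[p0 p1] /andP[e0 e1]; rewrite /score !addr0.
have h1 : a * ln (p + eta) <= _ := @mul_ln_le a (p + eta) a0 _.
have h2 := @mul_ln_le (1 - a) (1 - p + eta) _ _.
have {}h1 := h1 ltac:(lra); have {}h2 := h2 ltac:(lra) ltac:(lra).
have h3 : (a - (p + eta)) ^+ 2 / 8 <= _ := @sqr_sub_le_sqrt a (p + eta) ltac:(lra) ltac:(lra).
have h4 := sqr_ge0 (Num.sqrt (1 - a) - Num.sqrt (1 - p + eta)).
have h5 : (a - p) ^+ 2 <= (a - (p + eta)) ^+ 2 *+ 2 + eta ^+ 2 *+ 2.
  have := sqr_ge0 ((a - (p + eta)) - eta); lra.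
have h6 : eta ^+ 2 <= eta by nra.
lra.
Qed.

End RealInequalities.

(** * Bilinear forms of small Gram energy *)

Section BilinearForms.
Variable R : realType.

Lemma sqr_sum_le (I : finType) (w : I -> R) :
  (\sum_i w i) ^+ 2 <= #|I|%:R * \sum_i w i ^+ 2.
Proof.
rewrite expr2 mulr_suml.
have -> : #|I|%:R * \sum_i w i ^+ 2 =
    \sum_i \sum_j (w i ^+ 2 / 2 + w j ^+ 2 / 2).
  under [RHS]eq_bigr do rewrite big_split /= sumr_const.
  rewrite big_split /= sumr_const sumrMnl -mulrnDl.
  by rewrite -mulr_suml -splitr mulr_natl.
apply: ler_sum => i _; rewrite mulr_sumr; apply: ler_sum => j _.
have := sqr_ge0 (w i - w j); lra.
Qed.

Lemma sqr_lincomb_le (I : finType) (c w : I -> R) :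
  (forall i, `|c i| <= 1) ->
  (\sum_i c i * w i) ^+ 2 <= #|I|%:R * \sum_i w i ^+ 2.
Proof.
move=> c1; apply: (le_trans (sqr_sum_le _)).
rewrite ler_wpM2l ?ler0n //; apply: ler_sum => i _.
rewrite exprMn -[leRHS]mul1r ler_wpM2r ?sqr_ge0 //.
by rewrite -real_normK ?num_real // expr_le1.
Qed.

(** The squared Frobenius norm of [e * e^T]. *)
Definition gram_energy (n : nat) (e : 'M[R]_n) : R :=
  \sum_i \sum_i' (\sum_j e i j * e i' j) ^+ 2.

(** Two applications of Cauchy-Schwarz remove first [v], then [u]. The bound is
uniform in both vectors, and its right-hand side is a polynomial in the entries
of [e], so that its expectation only needs second moments. *)
Lemma bilinear_pow4_le (n : nat) (e : 'M[R]_n) (u v : 'I_n -> R) :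
  (forall i, `|u i| <= 1) -> (forall j, `|v j| <= 1) ->
  (\sum_i \sum_j e i j * (u i * v j)) ^+ 4 <= n%:R ^+ 4 * gram_energy e.
Proof.
move=> u1 v1.
have -> : \sum_i \sum_j e i j * (u i * v j) =
    \sum_j v j * \sum_i e i j * u i.
  rewrite exchange_big /=; apply: eq_bigr => j _.
  by rewrite mulr_sumr; apply: eq_bigr => i _; ring.
have h1 := @sqr_lincomb_le 'I_n v (fun j => \sum_i e i j * u i) v1.
have h2 : \sum_j (\sum_i e i j * u i) ^+ 2 =
    \sum_(k : 'I_n * 'I_n) (u k.1 * u k.2) * (\sum_j e k.1 j * e k.2 j).
  rewrite -(pair_bigA _ (fun i i' => (u i * u i') * \sum_j e i j * e i' j)) /=.
  under eq_bigr => j _ do rewrite expr2 big_distrlr.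
  rewrite exchange_big /=; apply: eq_bigr => i _.
  rewrite exchange_big /=; apply: eq_bigr => i' _.
  by rewrite mulr_sumr; apply: eq_bigr => j _; ring.
have h3 := @sqr_lincomb_le ('I_n * 'I_n)%type (fun k => u k.1 * u k.2)
  (fun k => \sum_j e k.1 j * e k.2 j).
have {}h3 := h3 (fun k => _).
rewrite -h2 in h3.
rewrite (exprM _ 2 2).
move: h1 h3; rewrite card_prod !card_ord /gram_energy.
rewrite (pair_bigA _ (fun i i' => (\sum_j e i j * e i' j) ^+ 2)) /=.
set A := (X in X ^+ 2 <= _); set B := \sum_j (_ ^+ 2); set G := \sum_(k : _ * _) _.
move=> h1 h3.
have {}h3 : B ^+ 2 <= (n * n)%:R * G.
  apply: h3 => k; rewrite normrM -[leRHS]mulr1; exact: ler_pM.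
apply: (@le_trans _ _ ((n%:R * B) ^+ 2)).
  by rewrite ler_pXn2r ?nnegrE ?sqr_ge0 // mulr_ge0 // sumr_ge0 // => j _; exact: sqr_ge0.
rewrite exprMn natrM in h3 *; rewrite (exprD _ 2 2) -mulrA.
by rewrite ler_wpM2l ?exprn_ge0 // expr2.
Qed.

End BilinearForms.

(** * Expectations under finite product laws *)

Section ProductExpectation.
Variables (R : realType) (I A : finType) (m : I -> A -> R).
Hypothesis m_ge0 : forall i a, 0 <= m i a.
Hypothesis m_sum : forall i, \sum_a m i a = 1.
Implicit Types F : {ffun I -> A} -> R.

Definition prod_mean F : R := \sum_(f : {ffun I -> A}) (\prod_i m i (f i)) * F f.

Lemma prod_mean_prod (g : I -> A -> R) :
  prod_mean (fun f : {ffun I -> A} => \prod_i g i (f i)) = \prod_i \sum_a m i a * g i a.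
Proof.
rewrite bigA_distr_bigA; apply: eq_bigr => f _.
by rewrite -big_split.
Qed.

Lemma prod_mean_cst c : prod_mean (fun=> c) = c.
Proof.
rewrite /prod_mean -mulr_suml.
have -> : \sum_(f : {ffun I -> A}) \prod_i m i (f i) = \prod_i \sum_a m i a.
  by rewrite bigA_distr_bigA.
by rewrite (eq_bigr _ (fun i _ => m_sum i)) big1_eq mul1r.
Qed.

Lemma ler_prod_mean F F' :
  (forall f : {ffun I -> A}, \prod_i m i (f i) != 0 -> F f <= F' f) -> prod_mean F <= prod_mean F'.
Proof.
move=> h; apply: ler_sum => f _.
have [->|n0] := eqVneq (\prod_i m i (f i)) 0; first by rewrite !mul0r.
by rewrite ler_wpM2l ?prodr_ge0 ?h.
Qed.

Lemma prod_mean_sum (J : finType) (F : J -> {ffun I -> A} -> R) :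
  prod_mean (fun f => \sum_j F j f) = \sum_j prod_mean (F j).
Proof.
rewrite exchange_big /=; apply: eq_bigr => f _; exact: mulr_sumr.
Qed.

Lemma prod_meanD F F' :
  prod_mean (fun f => F f + F' f) = prod_mean F + prod_mean F'.
Proof. by rewrite -big_split; apply: eq_bigr => f _; exact: mulrDr. Qed.

Lemma prod_meanZr F c : prod_mean (fun f => F f * c) = prod_mean F * c.
Proof. by rewrite /prod_mean mulr_suml; apply: eq_bigr => f _; rewrite mulrA. Qed.

Lemma eq_prod_mean F F' : F =1 F' -> prod_mean F = prod_mean F'.
Proof. by move=> h; apply: eq_bigr => f _; rewrite h. Qed.

(** Only the diagonal terms of the expanded square remain. *)
Lemma prod_mean_sqr_sum (J : finType) (y : J -> {ffun I -> A} -> R) :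
  (forall j j', j != j' -> prod_mean (fun f => y j f * y j' f) = 0) ->
  (forall j f, `|y j f| <= 1) ->
  prod_mean (fun f => (\sum_j y j f) ^+ 2) <= #|J|%:R.
Proof.
move=> y0 y1.
rewrite (@eq_prod_mean _ (fun f => \sum_j \sum_j' y j f * y j' f)); last first.
  by move=> f; rewrite expr2 big_distrlr.
rewrite prod_mean_sum -[X in _ <= X]sumr_const; apply: ler_sum => j _.
rewrite prod_mean_sum (bigD1 j) //= [X in _ + X]big1 ?addr0; last first.
  by move=> j' j'j; rewrite y0 // eq_sym.
rewrite -[leRHS](prod_mean_cst 1); apply: ler_prod_mean => f _.
apply: le_trans (ler_norm _) _; rewrite normrM -[leRHS]mulr1; exact: ler_pM.
Qed.

(** Independence, in the only form needed: a centred function of the coordinate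
[k] is uncorrelated with a product of functions of other coordinates. The list
[s] may visit a coordinate several times. *)
Lemma prod_mean_centred (k : I) (g : A -> R) (s : seq (I * (A -> R))) :
  \sum_a m k a * g a = 0 -> k \notin unzip1 s ->
  prod_mean (fun f : {ffun I -> A} => g (f k) * \prod_(h <- s) h.2 (f h.1)) = 0.
Proof.
move=> g0 ks.
pose G i a : R := (if i == k then g a else 1) * \prod_(h <- s | h.1 == i) h.2 a.
rewrite (@eq_prod_mean _ (fun f => \prod_i G i (f i))); last first.
  move=> f; rewrite big_split /=; congr (_ * _).
    by rewrite (bigD1 k) //= eqxx big1 ?mulr1 // => i /negbTE ->.
  rewrite (exchange_big_dep xpredT) //=; apply: eq_bigr => h _.
  by rewrite (eq_bigl (pred1 h.1)) ?big_pred1_eq // => i; rewrite /= eq_sym.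
rewrite prod_mean_prod; apply/eqP/prodf_eq0; exists k => //; apply/eqP.
rewrite -[RHS]g0; apply: eq_bigr => a _; rewrite /G eqxx big_seq_cond big1 ?mulr1 //.
by move=> h /andP[hs /eqP hk]; case/negP: ks; rewrite -hk map_f.
Qed.

End ProductExpectation.

(** * Fluctuations of the edges and of the class sizes *)

Section Noise.
Variables (R : realType) (Q n : nat).
Variables (p : 'M[R]_Q) (z : 'I_n -> 'I_Q).
Hypothesis p01 : forall q l, 0 <= p q l <= 1.

(** Diagonal entries are given the Dirac law at [false], so that the law of the
whole matrix is a product over all pairs. *)
Definition edge_pmf (k : 'I_n * 'I_n) (b : bool) : R :=
  if k.1 == k.2 then (~~ b)%:R else bernoulli_pmf (p (z k.1) (z k.2)) b.

Definition edge_noise (k : 'I_n * 'I_n) (b : bool) : R :=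
  if k.1 == k.2 then 0 else b%:R - p (z k.1) (z k.2).

Definition noise_mx (x : 'I_n -> 'I_n -> bool) : 'M[R]_n :=
  \matrix_(i, j) edge_noise (i, j) (x i j).

Lemma edge_pmf_ge0 k b : 0 <= edge_pmf k b.
Proof.
rewrite /edge_pmf /bernoulli_pmf; case: eqP => _; first exact: ler0n.
by have := p01 (z k.1) (z k.2); case: b; lra.
Qed.

Lemma edge_pmf_sum k : \sum_b edge_pmf k b = 1.
Proof.
rewrite big_bool /edge_pmf /bernoulli_pmf; case: eqP => _ /=; first by rewrite add0r.
by rewrite addrC subrK.
Qed.

Lemma edge_noise_centred k : \sum_b edge_pmf k b * edge_noise k b = 0.
Proof.
rewrite big_bool /edge_pmf /edge_noise /bernoulli_pmf.
by case: eqP => _ /=; [rewrite !mulr0 addr0 | rewrite mulr1n mulr0n; ring].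
Qed.

Lemma edge_noise_le1 k b : `|edge_noise k b| <= 1.
Proof.
rewrite /edge_noise; case: eqP => _; first by rewrite normr0.
by have := p01 (z k.1) (z k.2); rewrite ler_norml; case: b => /=; rewrite ?mulr1n ?mulr0n; lra.
Qed.

(** The noise matrix has independent centred entries. For [i != i'] the products
[e i j * e i' j], [j] varying, are uncorrelated, so each off-diagonal Gram entry
has second moment at most [n] where the trivial bound is [n ^ 2]. *)
Lemma gram_energy_mean :
  prod_mean edge_pmf
    (fun f => gram_energy (noise_mx (fun i j => f (i, j)))) <= 2 * n%:R ^+ 3.
Proof.
rewrite /gram_energy prod_mean_sum.
apply: (@le_trans _ _ (\sum_(i < n) (2 * n%:R ^+ 2))); last first.
  by rewrite sumr_const card_ord -[leLHS]mulr_natr -mulrA -exprSr.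
apply: ler_sum => i _; rewrite prod_mean_sum (bigD1 i) //=.
have nn (i' : 'I_n) : i' != i ->
  prod_mean edge_pmf (fun f => (\sum_j noise_mx (fun i j => f (i, j)) i j *
      noise_mx (fun i j => f (i, j)) i' j) ^+ 2) <= n%:R.
  move=> i'i.
  pose y j (f : {ffun 'I_n * 'I_n -> bool}) :=
    edge_noise (i, j) (f (i, j)) * edge_noise (i', j) (f (i', j)).
  rewrite (@eq_prod_mean _ _ _ _ _ (fun f => (\sum_j y j f) ^+ 2)); last first.
    by move=> f; congr (_ ^+ 2); apply: eq_bigr => j _; rewrite !mxE.
  rewrite -[X in _ <= X%:R](card_ord n); apply: prod_mean_sqr_sum => //.
  - exact: edge_pmf_ge0.
  - exact: edge_pmf_sum.
  - move=> j j' jj'.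
    (* The pair (i, j) differs from the three other pairs: from (i', j) and (i', j')
       because i != i', from (i, j') because j != j'. *)
    rewrite -[RHS](@prod_mean_centred _ _ _ edge_pmf (i, j) (edge_noise (i, j))
      [:: ((i', j), edge_noise (i', j)); ((i, j'), edge_noise (i, j'));
          ((i', j'), edge_noise (i', j'))]).
    + by apply: eq_bigr => f _; rewrite !big_cons big_nil /y /=; congr (_ * _); ring.
    + exact: edge_noise_centred.
    + by rewrite !inE !xpair_eqE (negbTE jj') eq_sym (negbTE i'i) !andbF.
  - move=> j f; rewrite normrM -[leRHS]mulr1.
    by apply: ler_pM => //; exact: edge_noise_le1.
have ii : prod_mean edge_pmf (fun f => (\sum_j noise_mx (fun i j => f (i, j)) i j *
      noise_mx (fun i j => f (i, j)) i j) ^+ 2) <= n%:R ^+ 2.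
  rewrite -[leRHS](prod_mean_cst (m := edge_pmf) edge_pmf_sum).
  apply: ler_prod_mean => [|f _]; first exact: edge_pmf_ge0.
  rewrite ler_pXn2r ?nnegrE ?sumr_ge0 // => [|j _]; last by rewrite -expr2 sqr_ge0.
  rewrite -[X in _ <= X%:R](card_ord n) -sumr_const; apply: ler_sum => j _.
  rewrite !mxE -expr2 -real_normK ?num_real // expr_le1 //; exact: edge_noise_le1.
have -> : 2 * n%:R ^+ 2 = n%:R ^+ 2 + n%:R ^+ 2 :> R by ring.
apply: lerD => //.
apply: le_trans (ler_sum _ nn) _; rewrite sumr_const -[leLHS]mulr_natr expr2.
by rewrite ler_wpM2l // ler_nat -[leqRHS]card_ord max_card.
Qed.

End Noise.

Section Labels.
Variables (R : realType) (Q n : nat) (a : 'rV[R]_Q).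
Hypothesis a01 : forall q, 0 < a 0 q < 1.
Hypothesis a_sum : \sum_q a 0 q = 1.

Definition class_size (z : 'I_n -> 'I_Q) (q : 'I_Q) : R := \sum_i (z i == q)%:R.

Lemma class_size_variance q :
  prod_mean (fun (_ : 'I_n) q => a 0 q)
    (fun z : {ffun 'I_n -> 'I_Q} => (class_size z q - n%:R * a 0 q) ^+ 2) <= n%:R.
Proof.
pose g (l : 'I_Q) : R := (l == q)%:R - a 0 q.
rewrite (@eq_prod_mean _ _ _ _ _ (fun z => (\sum_i g (z i)) ^+ 2)); last first.
  by move=> z; rewrite sumrB sumr_const card_ord mulr_natl.
rewrite -[X in _ <= X%:R](card_ord n); apply: prod_mean_sqr_sum => //.
- by move=> _ l; have := a01 l; lra.
- move=> i j ij.
  rewrite -[RHS](@prod_mean_centred _ _ _ (fun _ l => a 0 l) i g [:: (j, g)]).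
  + by apply: eq_bigr => f _; rewrite big_seq1.
  + rewrite (eq_bigr (fun l => a 0 l * (l == q)%:R - a 0 l * a 0 q)); last first.
      by move=> l _; rewrite mulrBr.
    rewrite sumrB -mulr_suml a_sum mul1r (bigD1 q) //= eqxx mulr1 big1 ?addr0 ?subrr //.
    by move=> l /negbTE ->; rewrite mulr0.
  + by rewrite inE.
- move=> i f; rewrite /g ler_norml; have := a01 q.
  by case: eqP => _ /=; rewrite ?mulr1n ?mulr0n; lra.
Qed.

End Labels.

(** * From a small mismatch to a relabelling *)

Section Coupling.
Variables (R : realType) (Q n : nat).
Variables (ps : 'M[R]_Q) (z : 'I_n -> 'I_Q) (t : 'M[R]_(n, Q)) (p : 'M[R]_Q).
Hypothesis t01 : forall i q, 0 <= t i q <= 1.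
Hypothesis t_sum : forall i, \sum_q t i q = 1.

(** The squared error of [p] as an estimate of the connection probabilities,
averaged, for each pair of nodes, over independent labels of laws [t i] and
[t j]. *)
Definition mismatch : R :=
  \sum_i \sum_j \sum_q \sum_l
    (ps (z i) (z j) - p q l) ^+ 2 * (t i q * t j l).

Definition overlap (k q : 'I_Q) : R := \sum_i (z i == k)%:R * t i q.

Lemma overlap_sum k : \sum_q overlap k q = class_size R z k.
Proof.
rewrite exchange_big; apply: eq_bigr => i _.
by rewrite -mulr_sumr t_sum mulr1.
Qed.

Lemma overlap_large k (m : R) :
  m * Q%:R <= class_size R z k -> exists q, m <= overlap k q.
Proof.
move=> hm; apply/existsP; apply: contraPT hm => /existsPn h; apply/negP.
rewrite -ltNge -overlap_sum.
rewrite mulr_natr -[Q in ltRHS]card_ord -sumr_const.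
apply: ltr_sum => [|q _]; last by rewrite ltNge.
by apply/hasP; exists k => //; exact: mem_index_enum.
Qed.

Lemma mismatch_overlap_le k k' q l :
  (ps k k' - p q l) ^+ 2 * (overlap k q * overlap k' l) <= mismatch.
Proof.
rewrite big_distrlr mulr_sumr /mismatch; apply: ler_sum => i _.
rewrite mulr_sumr; apply: ler_sum => j _ /=.
have tt_ge0 q' l' : 0 <= (ps (z i) (z j) - p q' l') ^+ 2 * (t i q' * t j l').
  have /andP[? _] := t01 i q'; have /andP[? _] := t01 j l'.
  by rewrite mulr_ge0 ?sqr_ge0 // mulr_ge0.
apply: (@le_trans _ _ ((ps (z i) (z j) - p q l) ^+ 2 * (t i q * t j l))).
  have [<-|_] := eqVneq (z i) k; last by rewrite !(mulr0n, mul0r, mulr0) tt_ge0.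
  have [<-|_] := eqVneq (z j) k'; last by rewrite !(mulr0n, mul0r, mulr0) tt_ge0.
  by rewrite !mul1r.
rewrite (bigD1 q) //= (bigD1 l) //= -addrA lerDl addr_ge0 ?sumr_ge0 // => q' _.
by rewrite sumr_ge0.
Qed.

(** Each true class gives a large overlap to some attributed class, by the
pigeonhole principle. A squared error between two such classes enters the
mismatch with weight at least [m ^ 2]. *)
Lemma class_map_of_mismatch (m kappa : R) : 0 < m ->
  (forall k, m * Q%:R <= class_size R z k) ->
  0 < kappa -> mismatch < (kappa * m) ^+ 2 ->
  exists s : 'I_Q -> 'I_Q, forall k k', `|p (s k) (s k') - ps k k'| < kappa.
Proof.
move=> m0 hm k0 hmis.
have [s hs] := fin_all_exists (fun k => overlap_large (hm k)).
exists s => k k'.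
have h := le_lt_trans (mismatch_overlap_le k k' (s k) (s k')) hmis.
have {}h : (ps k k' - p (s k) (s k')) ^+ 2 * m ^+ 2 < (kappa * m) ^+ 2.
  apply: le_lt_trans h; rewrite ler_wpM2l ?sqr_ge0 // expr2.
  by apply: ler_pM => //; exact: ltW.
move: h; rewrite -exprMn -real_normK ?num_real // ltr_pXn2r ?nnegrE ?mulr_ge0 // ?ltW //.
by rewrite normrM (gtr0_norm m0) ltr_pM2r // distrC.
Qed.

(** If two true classes were attributed the same class, their rows and columns in
[ps] would be within [2 * kappa] of each other, hence equal, against [A1]. So
the class map is a permutation. *)
Lemma relabel_of_class_map (kappa : R) (s : 'I_Q -> 'I_Q) : A1 ps ->
  (forall q l q' l', ps q l != ps q' l' -> 2 * kappa <= `|ps q l - ps q' l'|) ->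
  (forall k k', `|p (s k) (s k') - ps k k'| < kappa) ->
  exists s : 'S_Q, forall k k', `|relabel s p k k' - ps k k'| < kappa.
Proof.
move=> psA1 gap close.
have s_inj : injective s.
  move=> k k' skk'; apply/eqP/negPn/negP => /psA1[l].
  have near u v u' v' : p (s u) (s v) = p (s u') (s v') -> ps u v = ps u' v'.
    move=> e; apply/eqP; apply: contraTT isT => /gap; rewrite leNgt.
    have := close u v; have := close u' v'; rewrite e => h1 h2.
    have := ler_distD (p (s u') (s v')) (ps u v) (ps u' v').
    by rewrite (distrC (ps u v) (p _ _)); lra.
  by case; apply; apply: near; rewrite skk'.
by exists (perm s_inj) => k k'; rewrite mxE !permE.
Qed.

End Coupling.

(** * The pair likelihood and its mean *)

Section LogLikelihood.
Variables (R : realType) (Q n : nat).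
Implicit Types (t : 'M[R]_(n, Q)) (p : 'M[R]_Q) (x : 'I_n -> 'I_n -> R).

Definition pair_loglik eta x t p : R :=
  \sum_i \sum_(j | j != i) \sum_q \sum_l
    score eta (x i j) (p q l) * (t i q * t j l).

Definition one_hot (z : 'I_n -> 'I_Q) : 'M[R]_(n, Q) := \matrix_(i, q) (z i == q)%:R.

Lemma one_hot_variational z : variational_set (one_hot z).
Proof.
split=> [i q|i]; first by rewrite mxE; case: eqP => _ /=; lra.
rewrite (bigD1 (z i)) //= mxE eqxx big1 ?addr0 // => q qz.
by rewrite mxE eq_sym (negbTE qz).
Qed.

Lemma sum_weights t i j (c : R) : variational_set t ->
  \sum_q \sum_l c * (t i q * t j l) = c.
Proof.
move=> [_ t1]; under eq_bigr do under eq_bigr do rewrite mulrA.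
by under eq_bigr do rewrite -mulr_sumr t1 mulr1; rewrite -mulr_sumr t1 mulr1.
Qed.

Lemma sum_one_hot z i j (F : 'I_Q -> 'I_Q -> R) :
  \sum_q \sum_l F q l * (one_hot z i q * one_hot z j l) = F (z i) (z j).
Proof.
rewrite (bigD1 (z i)) //= [X in _ + X]big1 ?addr0; last first.
  by move=> q qz; rewrite big1 // => l _; rewrite !mxE eq_sym (negbTE qz) mul0r mulr0.
rewrite (bigD1 (z j)) //= [X in _ + X]big1 ?addr0; last first.
  by move=> l lz; rewrite !mxE [z j == l]eq_sym (negbTE lz) !mulr0.
by rewrite !mxE !eqxx !mulr1.
Qed.

Variables (ps : 'M[R]_Q) (z : 'I_n -> 'I_Q) (y : 'I_n -> 'I_n -> bool).
Hypothesis ps01 : forall q l, 0 <= ps q l <= 1.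
Let x i j : R := (y i j)%:R.
Let a i j : R := ps (z i) (z j).

(** The pair likelihood is affine in the data [x], hence its deviation from its
conditional mean is a combination of bilinear forms of the noise evaluated at
the columns of [t]. *)
Lemma pair_loglik_noise eta t p :
  pair_loglik eta x t p - pair_loglik eta a t p =
  \sum_q \sum_l (ln (p q l + eta) - ln (1 - p q l + eta)) *
    \sum_i \sum_j noise_mx ps z y i j * (t i q * t j l).
Proof.
pose F i j q l := (ln (p q l + eta) - ln (1 - p q l + eta)) *
  (noise_mx ps z y i j * (t i q * t j l)).
transitivity (\sum_i \sum_j \sum_q \sum_l F i j q l); last first.
  under [RHS]eq_bigr do under eq_bigr do rewrite mulr_sumr.
  under [RHS]eq_bigr do under eq_bigr do under eq_bigr do rewrite mulr_sumr.
  rewrite pair_bigA [RHS]pair_bigA /=.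
  under eq_bigr do rewrite pair_bigA /=.
  under [RHS]eq_bigr do rewrite pair_bigA /=.
  exact: exchange_big.
rewrite /pair_loglik -sumrB; apply: eq_bigr => i _.
rewrite [RHS](bigD1 i) //= [X in _ = X + _]big1 ?add0r; last first.
  by move=> q _; rewrite big1 // => l _; rewrite /F mxE /edge_noise eqxx mul0r mulr0.
rewrite -sumrB; apply: eq_bigr => j ji.
rewrite -sumrB; apply: eq_bigr => q _.
rewrite -sumrB; apply: eq_bigr => l _.
by rewrite /F mxE /edge_noise /= eq_sym (negbTE ji) /score /x /a; ring.
Qed.

Lemma noise_bilinear_le (delta : R) (u v : 'I_n -> R) : 0 <= delta ->
  gram_energy (noise_mx ps z y) <= (delta * n%:R) ^+ 4 ->
  (forall i, `|u i| <= 1) -> (forall j, `|v j| <= 1) ->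
  `|\sum_i \sum_j noise_mx ps z y i j * (u i * v j)| <= delta * n%:R ^+ 2.
Proof.
move=> d0 hE u1 v1.
rewrite -(@ler_pXn2r _ 4) ?nnegrE ?mulr_ge0 // -normrX.
rewrite ger0_norm ?exprn_even_ge0 //.
apply: le_trans (bilinear_pow4_le _ u1 v1) _.
apply: (@le_trans _ _ (n%:R ^+ 4 * (delta * n%:R) ^+ 4)).
  by rewrite ler_wpM2l.
by rewrite -exprMn lerXn2r ?nnegrE ?mulr_ge0 //; lra.
Qed.

Lemma pair_loglik_noise_le (delta K eta : R) t p : 0 <= delta ->
  gram_energy (noise_mx ps z y) <= (delta * n%:R) ^+ 4 ->
  variational_set t ->
  (forall q l, `|ln (p q l + eta) - ln (1 - p q l + eta)| <= K) ->
  `|pair_loglik eta x t p - pair_loglik eta a t p| <=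
  Q%:R ^+ 2 * K * delta * n%:R ^+ 2.
Proof.
move=> d0 hE [t01 _] hK; rewrite pair_loglik_noise.
have -> : Q%:R ^+ 2 * K * delta * n%:R ^+ 2 =
    \sum_(q < Q) \sum_(l < Q) K * (delta * n%:R ^+ 2).
  by rewrite !sumr_const card_ord -mulrnA -[RHS]mulr_natl natrM; ring.
have t1 i q : `|t i q| <= 1 by have := t01 i q; rewrite ler_norml; lra.
apply: le_trans (ler_norm_sum _ _ _) _; apply: ler_sum => q _.
apply: le_trans (ler_norm_sum _ _ _) _; apply: ler_sum => l _.
rewrite normrM; apply: ler_pM => //.
exact: (@noise_bilinear_le delta (t^~ q) (t^~ l)).
Qed.

(** Up to the smoothing error, the mean likelihood is maximal at the true labels
and parameters, and the deficit controls the mismatch. The last term of the right-hand side pays for the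
diagonal pairs, present in the mismatch only. *)
Lemma pair_loglik_excess (eta : R) t p : 0 < eta <= 1 ->
  (forall q l, 0 <= p q l <= 1) -> variational_set t ->
  pair_loglik eta a t p + mismatch ps z t p / 16 <=
  pair_loglik 0 a (one_hot z) ps + 3 * eta * n%:R ^+ 2 + n%:R / 16.
Proof.
move=> eta01 p01 tV; have [t01 t1] := tV.
rewrite -[leRHS]addrA; have -> : 3 * eta * n%:R ^+ 2 + n%:R / 16 =
    \sum_(i < n) (\sum_(j < n) 3 * eta + 1 / 16).
  by rewrite big_split /= !sumr_const !card_ord -mulrnA -[_ *+ (n * n)]mulr_natl
    -[(1 / 16) *+ n]mulr_natl natrM; ring.
rewrite /pair_loglik /mismatch mulr_suml -!big_split /=; apply: ler_sum => i _.
pose M j := \sum_q \sum_l (ps (z i) (z j) - p q l) ^+ 2 * (t i q * t j l).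
rewrite -/M (bigD1 (F := M) i) // [in leRHS](bigD1 (F := fun=> 3 * eta) i) //=.
have sq_le1 j : M j <= 1.
  rewrite -[leRHS](sum_weights i j 1 tV); apply: ler_sum => q _; apply: ler_sum => l _.
  have /andP[? _] := t01 i q; have /andP[? _] := t01 j l.
  rewrite ler_wpM2r ?mulr_ge0 //.
  rewrite -real_normK ?num_real // expr_le1 // ler_norml.
  by have := p01 q l; have := ps01 (z i) (z j); lra.
have off j : j != i ->
    \sum_q \sum_l score eta (a i j) (p q l) * (t i q * t j l) +
    M j / 16 <=
    \sum_q \sum_l score 0 (a i j) (ps q l) * (one_hot z i q * one_hot z j l) +
    3 * eta.
  move=> _; rewrite sum_one_hot -/(a i j).
  rewrite -[leRHS](sum_weights i j _ tV) mulr_suml -big_split /=.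
  apply: ler_sum => q _; rewrite mulr_suml -big_split /=; apply: ler_sum => l _.
  have /andP[? _] := t01 i q; have /andP[? _] := t01 j l.
  rewrite mulrAC -mulrDl ler_wpM2r ?mulr_ge0 //.
  by have := @score_gap R (a i j) (p q l) eta (ps01 _ _) (p01 _ _) eta01; rewrite /a; lra.
have := ler_sum (index_enum 'I_n) off; rewrite !big_split /= -mulr_suml.
have := sq_le1 i; lra.
Qed.

(** Near-optimality of [t] for the data transfers to the mean, because both
likelihoods are within the noise bound of their means. *)
Lemma mismatch_le (delta K eta C : R) t p : 0 <= delta -> 0 < eta <= 1 ->
  gram_energy (noise_mx ps z y) <= (delta * n%:R) ^+ 4 ->
  (forall q l, 0 <= p q l <= 1) -> variational_set t ->
  (forall q l, `|ln (p q l + eta) - ln (1 - p q l + eta)| <= K) ->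
  (forall q l, `|ln (ps q l + 0) - ln (1 - ps q l + 0)| <= K) ->
  pair_loglik 0 x (one_hot z) ps - C * n%:R <= pair_loglik eta x t p ->
  mismatch ps z t p <=
    (32 * Q%:R ^+ 2 * K * delta + 48 * eta) * n%:R ^+ 2 + (16 * C + 1) * n%:R.
Proof.
move=> d0 eta01 hE p01 tV hK hKs hmax.
have := pair_loglik_noise_le d0 hE tV hK.
have := pair_loglik_noise_le d0 hE (one_hot_variational z) hKs.
have := pair_loglik_excess eta01 p01 tV.
rewrite !ler_norml; set N := n%:R in hmax *.
set W := Q%:R ^+ 2 * K * delta * N ^+ 2.
have -> : (32 * Q%:R ^+ 2 * K * delta + 48 * eta) * N ^+ 2 =
  32 * W + 48 * eta * N ^+ 2 by rewrite /W; ring.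
lra.
Qed.

End LogLikelihood.

(** * Bounds on the logarithms *)

Section LogBounds.
Variable R : realType.

Lemma norm_ln_smooth (eta p : R) : 0 < eta <= 1 -> 0 <= p <= 1 ->
  `|ln (p + eta)| <= 1 + `|ln eta|.
Proof.
move=> /andP[e0 e1] /andP[p0 p1].
have h1 : ln eta <= ln (p + eta) by rewrite ler_ln ?posrE; lra.
have h2 := @ln_le_sub1 R (p + eta) ltac:(lra).
have h3 := ler_norm (- ln eta); rewrite normrN in h3.
have h4 := normr_ge0 (ln eta).
by rewrite ler_norml; apply/andP; split; lra.
Qed.

(** The endpoints 0 and 1 are covered by [ln 0 = ln 1 = 0]. *)
Lemma norm_ln_away (zeta p : R) : 0 < zeta -> 0 <= p <= 1 ->
  (0 < p < 1 -> zeta <= p <= 1 - zeta) -> `|ln p| <= `|ln zeta|.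
Proof.
move=> z0 /andP[p0 p1] hp.
move: p0; rewrite le_eqVlt => /predU1P[<-|p0]; first by rewrite ln0 ?normr0.
move: p1; rewrite le_eqVlt => /predU1P[->|p1]; first by rewrite ln1 normr0.
have /andP[zp _] : zeta <= p <= 1 - zeta by apply: hp; rewrite p0 p1.
have h1 : ln zeta <= ln p by rewrite ler_ln ?posrE.
have h2 := @ln_le0 R p (ltW p1).
by rewrite !ler0_norm ?lerN2 //; exact: le_trans h1 h2.
Qed.

End LogBounds.

(** * Comparison with the extended-real objective *)

Section ExtendedLikelihood.
Variables (R : realType) (Q n : nat).
Implicit Types (x : 'M[bool]_n) (t : 'M[R]_(n, Q)).
Implicit Types (a : 'rV[R]_Q) (p : 'M[R]_Q).

Definition edge_score (b : bool) (u : R) : \bar R :=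
  (b%:R%:E * lne u%:E + (1 - b%:R)%:E * lne (1 - u)%:E)%E.

(** An edge variable of positive probability: the true parameter gives a finite
likelihood to the data exactly when all of them are possible. *)
Definition possible_edge (u : R) (b : bool) : bool := bernoulli_pmf u b != 0.

Lemma edge_score_fin b u : 0 <= u <= 1 -> possible_edge u b ->
  edge_score b u = (score 0 b%:R u)%:E.
Proof.
rewrite /edge_score /score /possible_edge /bernoulli_pmf !addr0 => /andP[u0 u1].
case: b => ub.
  rewrite mulr1n subrr mul0e adde0 mul0r addr0 mul1e mul1r lne_EFin //.
  by rewrite lt_neqAle eq_sym ub.
rewrite mulr0n subr0 mul0e add0e mul0r add0r mul1e mul1r lne_EFin //.
by rewrite lt_neqAle eq_sym ub subr_ge0.
Qed.

Lemma edge_score_le eta b u : 0 < eta -> 0 <= u <= 1 ->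
  (edge_score b u <= (score eta b%:R u)%:E)%E.
Proof.
move=> e0 /andP[u0 u1].
have lne_le (v : R) : 0 <= v -> (lne v%:E <= (ln (v + eta))%:E)%E.
  move=> v0; rewrite -lne_EFin; last by lra.
  by rewrite lee_lne ?in_itv /= ?leey ?andbT ?lee_fin; lra.
rewrite /edge_score /score [leRHS]EFinD !EFinM; apply: leeD; apply: lee_wpmul2l.
- by rewrite lee_fin.
- exact: lne_le.
- by rewrite lee_fin; case: b => /=; rewrite ?mulr1n ?mulr0n; lra.
- by apply: lne_le; lra.
Qed.

(** The entropy of the weights is at most [Q] per node since [- u * ln u <= 1],
and the logarithms of the class proportions are negative. *)
Lemma variational_loglik_le eta x t a p : 0 < eta ->
  (forall q, 0 < a 0 q < 1) -> (forall q l, 0 <= p q l <= 1) ->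
  variational_set t ->
  (variational_loglik x t a p <=
   (pair_loglik eta (fun i j => (x i j)%:R) t p + Q%:R * n%:R)%:E)%E.
Proof.
move=> e0 a01 p01 [t01 _].
rewrite /variational_loglik -[Q%:R * n%:R]opprK EFinB; apply: leeB.
  rewrite /pair_loglik -sumEFin.
  apply: lee_sum => i _; rewrite -sumEFin; apply: lee_sum => j _.
  rewrite -sumEFin; apply: lee_sum => q _; rewrite -sumEFin; apply: lee_sum => l _.
  rewrite [leRHS]EFinM; apply: lee_wpmul2r.
    have /andP[? _] := t01 i q; have /andP[? _] := t01 j l.
    by rewrite lee_fin mulr_ge0.
  exact: edge_score_le.
have -> : (- (Q%:R * n%:R))%:E = (\sum_(i < n) \sum_(q < Q) (- 1)%:E)%E :> \bar R.
  by rewrite !sumEFin !sumr_const !card_ord -mulrnA -[in RHS]mulr_natr natrM mulN1r.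
apply: lee_sum => i _; apply: lee_sum => q _.
have /andP[t0 t1] := t01 i q; have /andP[a0 a1] := a01 q.
move: t0; rewrite le_eqVlt => /predU1P[<-|t0]; first by rewrite mul0e lee_fin; lra.
rewrite !lne_EFin // -EFinB -EFinM lee_fin.
have := @mul_ln_le R (t i q) 1 (ltW t0) ltr01; rewrite ln1 => h1.
have := sqr_ge0 (Num.sqrt (t i q) - Num.sqrt 1).
have : t i q * ln (a 0 q) <= 0 by rewrite mulr_ge0_le0 ?ltW // ln_lt0 ?a0.
lra.
Qed.

(** At one-hot weights the entropy vanishes, leaving the log-probability of the
labels, which is of order [n]. *)
Lemma variational_loglik_one_hot_ge gamma x (z : 'I_n -> 'I_Q) a p :
  0 < gamma -> (forall q, gamma <= a 0 q) -> (forall q l, 0 <= p q l <= 1) ->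
  (forall i j, i != j -> possible_edge (p (z i) (z j)) (x i j)) ->
  ((pair_loglik 0 (fun i j => (x i j)%:R) (one_hot R z) p + ln gamma * n%:R)%:E
   <= variational_loglik x (one_hot R z) a p)%E.
Proof.
move=> g0 ag p01 xz.
rewrite /variational_loglik -[ln gamma * n%:R]opprK EFinB; apply: leeB.
  rewrite /pair_loglik -sumEFin.
  apply: lee_sum => i _; rewrite -sumEFin; apply: lee_sum => j ji.
  rewrite -sumEFin; apply: lee_sum => q _; rewrite -sumEFin; apply: lee_sum => l _.
  rewrite -/(edge_score _ _) !mxE.
  have [<-|_] := eqVneq (z i) q; last by rewrite /= mulr0n mul0r mulr0 mule0.
  have [<-|_] := eqVneq (z j) l; last by rewrite /= mulr0n !mulr0 mule0.
  by rewrite edge_score_fin ?xz 1?eq_sym // EFinM.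
have -> : (- (ln gamma * n%:R))%:E =
    (\sum_(i < n) \sum_(q < Q) (one_hot R z i q * - ln gamma)%:E)%E :> \bar R.
  under eq_bigr do rewrite sumEFin -mulr_suml (one_hot_variational R z).2 mul1r.
  by rewrite sumEFin sumr_const card_ord -mulNr mulr_natr.
apply: lee_sum => i _; apply: lee_sum => q _; rewrite !mxE.
case: eqP => _; last by rewrite /= mulr0n mul0e mul0r.
have a0 := lt_le_trans g0 (ag q).
by rewrite mulr1n mul1e mul1r lne1 sub0e lne_EFin // lee_fin lerN2 ler_ln.
Qed.

(** Since the entropy and class proportion terms are of order [n], they are
negligible against the pair likelihood, of order [n ^ 2]. The [+ 1] in the
constant leaves room for weights that are optimal up to 1 instead of optimal. *)
Lemma argmax_pair_loglik zeta gamma eta x (z : 'I_n -> 'I_Q) a p a' p' :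
  (1 < n)%N -> 0 < gamma -> 0 < eta ->
  admissible zeta gamma a p -> is_variational_argmax zeta gamma x a' p' ->
  (forall i j, i != j -> possible_edge (p (z i) (z j)) (x i j)) ->
  exists2 t, variational_set t &
    pair_loglik 0 (fun i j => (x i j)%:R) (one_hot R z) p
      - (`|ln gamma| + Q%:R + 1) * n%:R
    <= pair_loglik eta (fun i j => (x i j)%:R) t p'.
Proof.
move=> n1 g0 e0 adm [adm' /(_ _ _ adm) hmax] xz.
have [[_ _ p01] _ _ ag] := adm.
have [[a'01 _ p'01] _ _ _] := adm'.
have hp : (0 < (n * n.-1)%:R^-1 :> R) by rewrite invr_gt0 ltr0n muln_gt0; case: (n) n1 => [|[]].
move: hmax; rewrite /Jn lee_pmul2l // ?lte_fin // => hmax.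
set S := pair_loglik 0 _ _ _.
have lt_sup : ((S + ln gamma * n%:R - 1)%:E < ereal_sup
    [set variational_loglik x t a' p' | t in @variational_set R Q n])%E.
  apply: lt_le_trans hmax.
  apply: (@lt_le_trans _ _ ((S + ln gamma * n%:R)%:E)); first by rewrite lte_fin; lra.
  have h := @variational_loglik_one_hot_ge gamma x z a p g0 _ p01 xz.
  apply: le_trans (h _) _; first by move=> q; have /andP[] := ag q.
  by apply: ereal_sup_ubound; exists (one_hot R z) => //; exact: one_hot_variational.
have [_ [t tV <-] /lt_le_trans ht] := ereal_sup_gt lt_sup.
exists t => //.
have := ht _ (variational_loglik_le x e0 a'01 p'01 tV); rewrite lte_fin.
have : - ln gamma * n%:R <= `|ln gamma| * n%:R by rewrite ler_wpM2r // -normrN ler_norm.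
have : 1 <= n%:R :> R by rewrite ler1n ltnW.
lra.
Qed.

End ExtendedLikelihood.

(** * Events of the sample *)

Lemma measure_bigsetU_le (d : measure_display) (T : measurableType d)
    (R : realType) (P : probability T R) (K : finType) (C : pred K)
    (F : K -> set T) : (forall k, measurable (F k)) ->
  measurable (\big[setU/set0]_(k | C k) F k) /\
  (P (\big[setU/set0]_(k | C k) F k) <= \sum_(k | C k) P (F k))%E.
Proof.
move=> mF; apply: (big_ind2 (fun A s => measurable A /\ (P A <= s)%E)).
- by rewrite measure0.
- move=> A s B s' [mA hA] [mB hB]; split; first exact: measurableU.
  by apply: le_trans (measureU2 _ mA mB) _; exact: leeD.
- by move=> k _; split.
Qed.

Section SampleEvents.
Context {d : measure_display} {T : measurableType d} {R : realType}.
Variables (P : probability T R) (Q : nat).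
Variables (Z : nat -> T -> 'I_Q) (X : nat -> nat -> T -> bool).
Variables (a : 'rV[R]_Q) (ps : 'M[R]_Q).
Hypothesis sbm : is_sbm P Z X a ps.
Variable n : nat.
Implicit Types (z : {ffun 'I_n -> 'I_Q}) (f : {ffun 'I_n * 'I_n -> bool}).

Definition labels w : {ffun 'I_n -> 'I_Q} := [ffun i : 'I_n => Z i w].
Definition edges w : {ffun 'I_n * 'I_n -> bool} :=
  [ffun k : 'I_n * 'I_n => X k.1 k.2 w].
Definition mx_of f : 'M[bool]_n := \matrix_(i, j) f (i, j).

Lemma adjacencyE w : adjacency X n w = mx_of (edges w).
Proof. by apply/matrixP => i j; rewrite !mxE ffunE. Qed.

Lemma measurable_labels_are z : measurable (labels_are Z z).
Proof.
have [[mZ _ _] _ _ _] := sbm.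
rewrite (_ : labels_are Z z = \bigcap_(i in [set: 'I_n]) (Z i @^-1` [set z i])).
  by apply: fin_bigcap_measurable => // i _; exact: mZ.
by apply/seteqP; split=> w h i; [move=> _; exact: h | exact: (h i)].
Qed.

Lemma measurable_edges_are (x : 'M[bool]_n) : measurable (edges_are X x).
Proof.
have [_ mX _ _] := sbm.
rewrite (_ : edges_are X x = \bigcap_(k in [set k : 'I_n * 'I_n | k.1 != k.2])
  (X k.1 k.2 @^-1` [set x k.1 k.2])).
  apply: fin_bigcap_measurable => // k _.
  by rewrite -[X in measurable X]setTI; exact: mX.
apply/seteqP; split=> w h; first by move=> [i j] /= ij; exact: h.
by move=> i j ij; exact: (h (i, j)).
Qed.

Lemma labels_are_prob z : P (labels_are Z z) = (\prod_i a 0 (z i))%:E.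
Proof.
have [[mZ PZ indep] _ _ _] := sbm.
pose A k : set 'I_Q := [set q | forall i : 'I_n, val i = k -> z i = q].
have AE (i : 'I_n) : A i = [set z i].
  apply/seteqP; split=> [q /(_ i erefl) <-//|q -> j /val_inj -> //].
pose s := [seq val i | i <- enum 'I_n].
have sU : uniq s by rewrite (map_inj_uniq val_inj) enum_uniq.
have -> : labels_are Z z = \bigcap_(i in [set` s]) (Z i @^-1` A i).
  apply/seteqP; split=> w h; first by move=> _ /mapP[i _ ->]; rewrite AE; exact: h.
  move=> i; have := h i; rewrite /= AE; apply.
  by apply/mapP; exists i; rewrite ?mem_enum.
rewrite indep // big_map big_enum /= -prodEFin.
by apply: eq_big => // i _; rewrite AE PZ.
Qed.

Definition sample z f : set T := labels_are Z z `&` edges_are X (mx_of f).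

Lemma measurable_sample z f : measurable (sample z f).
Proof. by apply: measurableI; [exact: measurable_labels_are | exact: measurable_edges_are]. Qed.

(** The diagonal of the data is always [false], but [edges_are] does not look at
it: matrices that differ only on the diagonal would index the same event. *)
Definition loopless f := [forall i, ~~ f (i, i)].

Lemma sample_prob z f : loopless f ->
  P (sample z f) = ((\prod_i a 0 (z i)) * \prod_k edge_pmf ps z k (f k))%:E.
Proof.
move=> /forallP ff; have [_ _ _ edge_law] := sbm.
rewrite /sample edge_law labels_are_prob -EFinM; congr (_ * _)%:E.
rewrite (eq_bigr (fun k => edge_pmf ps z (k.1, k.2) (f (k.1, k.2)))); last by case.
rewrite -(pair_bigA _ (fun i j => edge_pmf ps z (i, j) (f (i, j)))) /=.
apply: eq_bigr => i _; rewrite [RHS](bigD1 i) //=.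
rewrite {1}/edge_pmf eqxx /= (negbTE (ff i)) mul1r; apply: eq_bigr => j ji.
by rewrite /edge_pmf /= eq_sym (negbTE ji) mxE.
Qed.

Variable B : {ffun 'I_n -> 'I_Q} -> {ffun 'I_n * 'I_n -> bool} -> bool.

Lemma sample_eventE :
  [set w | B (labels w) (edges w)] =
  \big[setU/set0]_(k in [pred k | loopless k.2 && B k.1 k.2]) sample k.1 k.2.
Proof.
have [_ _ diag _] := sbm.
rewrite -bigcup_pred; apply/seteqP; split=> w.
  move=> Bw; exists (labels w, edges w) => /=.
    by rewrite inE /= Bw andbT; apply/forallP => i; rewrite ffunE diag.
  by split=> [i|i j ij]; rewrite ?mxE ffunE.
move=> [[z f]]; rewrite /= inE /= => /andP[/forallP ff Bzf] [lz ef].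
have -> : labels w = z by apply/ffunP => i; rewrite ffunE lz.
suff -> : edges w = f by [].
apply/ffunP => -[i j]; rewrite ffunE /=.
have [<-|ij] := eqVneq i j; first by rewrite diag; exact/esym/negbTE.
by rewrite ef // mxE.
Qed.

Lemma measurable_sample_event : measurable [set w | B (labels w) (edges w)].
Proof.
by rewrite sample_eventE; apply: (measure_bigsetU_le P _ _).1 => k; exact: measurable_sample.
Qed.

Hypothesis a_ge0 : forall q, 0 <= a 0 q.
Hypothesis ps01 : forall q l, 0 <= ps q l <= 1.

(** This reduces probabilities to iterated finite expectations: over the labels,
then over the edges given the labels. *)
Lemma sample_event_prob_le :
  (P [set w | B (labels w) (edges w)] <=
   (prod_mean (fun (_ : 'I_n) q => a 0 q) (fun z =>
      prod_mean (edge_pmf ps z) (fun f => (B z f)%:R)))%:E)%E.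
Proof.
rewrite sample_eventE.
apply: le_trans (measure_bigsetU_le P _ _).2 _; first by move=> k; exact: measurable_sample.
rewrite /prod_mean; under [in leRHS]eq_bigr do rewrite mulr_sumr.
rewrite pair_bigA /= -sumEFin big_mkcond /=; apply: lee_sum => -[z f] _ /=.
have p0 : 0 <= \prod_i a 0 (z i) * \prod_k edge_pmf ps z k (f k).
  by rewrite mulr_ge0 ?prodr_ge0 // => k _; exact: edge_pmf_ge0.
rewrite inE /=; case: ifPn => [/andP[ff ->]|_].
  by rewrite sample_prob // mulr1n mulr1.
by rewrite lee_fin mulrA mulr_ge0.
Qed.

End SampleEvents.

(** * Typical samples *)

Section Typical.
Variables (R : realType) (Q n : nat) (a : 'rV[R]_Q) (ps : 'M[R]_Q).

Definition typical (delta gamma : R) (z : {ffun 'I_n -> 'I_Q})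
    (f : {ffun 'I_n * 'I_n -> bool}) : bool :=
  [&& gram_energy (noise_mx ps z (fun i j => f (i, j))) <= (delta * n%:R) ^+ 4,
      [forall q, gamma / 2 * n%:R <= class_size R z q] &
      [forall i, forall j, (i != j) ==> possible_edge (ps (z i) (z j)) (f (i, j))]].

Lemma indicator_markov (u v : R) : 0 <= u -> 0 < v -> (~~ (u <= v))%:R <= u / v.
Proof.
move=> u0 v0; case: (leP u v) => /= [_|uv]; first by rewrite mulr0n divr_ge0 // ltW.
by rewrite mulr1n ler_pdivlMr // mul1r ltW.
Qed.

(** The class size [u] is expected to be [n * c], at least twice the threshold. *)
Lemma indicator_chebyshev (u c gamma : R) : 0 < gamma -> gamma <= c -> 0 < n%:R :> R ->
  (~~ (gamma / 2 * n%:R <= u))%:R <= (u - n%:R * c) ^+ 2 / (gamma / 2 * n%:R) ^+ 2.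
Proof.
move=> g0 gc n0; have m0 : 0 < gamma / 2 * n%:R by rewrite mulr_gt0 ?divr_gt0.
case: (leP (gamma / 2 * n%:R) u) => /= [_|hu]; first by rewrite mulr0n mulr_ge0 ?invr_ge0 ?sqr_ge0.
rewrite mulr1n ler_pdivlMr ?exprn_gt0 // mul1r -[leRHS]sqrrN opprB.
rewrite lerXn2r ?nnegrE ?ltW //.
  have : gamma * n%:R <= n%:R * c by rewrite mulrC ler_pM2l.
  lra.
have : gamma * n%:R <= n%:R * c by rewrite mulrC ler_pM2l.
lra.
Qed.

Hypothesis a01 : forall q, 0 < a 0 q < 1.
Hypothesis a_sum : \sum_q a 0 q = 1.
Hypothesis ps01 : forall q l, 0 <= ps q l <= 1.

(** Markov's inequality for the Gram energy, of mean at most [2 * n ^ 3] against a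
threshold of order [n ^ 4], and Chebyshev's inequality for each class size.
Impossible edges have probability 0. *)
Lemma atypical_mean_le (delta gamma : R) : (0 < n)%N -> 0 < delta -> 0 < gamma ->
  (forall q, gamma <= a 0 q) ->
  prod_mean (fun (_ : 'I_n) q => a 0 q) (fun z =>
      prod_mean (edge_pmf ps z) (fun f => (~~ typical delta gamma z f)%:R)) <=
  (2 / delta ^+ 4 + Q%:R * (4 / gamma ^+ 2)) / n%:R.
Proof.
move=> n_gt0 d0 g0 ag; have n0 : 0 < n%:R :> R by rewrite ltr0n.
pose E (z : {ffun 'I_n -> 'I_Q}) (f : {ffun 'I_n * 'I_n -> bool}) := gram_energy (noise_mx ps z (fun i j => f (i, j))).
pose V (z : {ffun 'I_n -> 'I_Q}) := \sum_q (class_size R z q - n%:R * a 0 q) ^+ 2.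
have m1 (z : {ffun 'I_n -> 'I_Q}) k := edge_pmf_sum ps z k.
have m0 (z : {ffun 'I_n -> 'I_Q}) k b := edge_pmf_ge0 z ps01 k b.
have a_ge0 (i : 'I_n) q : 0 <= a 0 q by have /andP[/ltW] := a01 q.
apply: (@le_trans _ _ (prod_mean (fun (_ : 'I_n) q => a 0 q) (fun z =>
    2 * n%:R ^+ 3 / (delta * n%:R) ^+ 4 + V z / (gamma / 2 * n%:R) ^+ 2))).
  apply: (ler_prod_mean a_ge0) => z _.
  apply: (@le_trans _ _ (prod_mean (edge_pmf ps z) (fun f =>
      E z f / (delta * n%:R) ^+ 4 + V z / (gamma / 2 * n%:R) ^+ 2))); last first.
    rewrite prod_meanD (prod_mean_cst (m1 z)) lerD2r prod_meanZr.
    rewrite ler_wpM2r ?invr_ge0 ?exprn_ge0 ?mulr_ge0 ?(ltW d0) //.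
    exact: gram_energy_mean.
  apply: (ler_prod_mean (m0 z)) => f f0.
  have E0 : 0 <= E z f by apply: sumr_ge0 => i _; apply: sumr_ge0 => j _; exact: sqr_ge0.
  have dn0 : 0 < (delta * n%:R) ^+ 4 by rewrite exprn_gt0 ?mulr_gt0.
  have gn0 : 0 < (gamma / 2 * n%:R) ^+ 2 by rewrite exprn_gt0 ?mulr_gt0.
  have V0 : 0 <= V z by apply: sumr_ge0 => q _; exact: sqr_ge0.
  have possible :
      [forall i, forall j, (i != j) ==> possible_edge (ps (z i) (z j)) (f (i, j))].
    apply/forallP => i; apply/forallP => j; apply/implyP => ij.
    move/prodf_neq0: f0 => /(_ (i, j) isT).
    by rewrite /edge_pmf /= (negbTE ij).
  rewrite /typical possible andbT negb_and.
  have [hE|hE] /= := boolP (~~ (_ <= _)).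
    apply: (@le_trans _ _ (E z f / (delta * n%:R) ^+ 4)); last first.
      by rewrite lerDl divr_ge0 // ltW.
    by have := indicator_markov E0 dn0; rewrite hE.
  apply: (@le_trans _ _ (V z / (gamma / 2 * n%:R) ^+ 2)); last first.
    by rewrite lerDr divr_ge0 // ltW.
  case: (boolP [forall q, _]) => [_|/forallPn[q hq]].
    by rewrite mulr0n divr_ge0 // ltW.
  apply: le_trans (_ : (class_size R z q - n%:R * a 0 q) ^+ 2 /
     (gamma / 2 * n%:R) ^+ 2 <= _); last first.
    rewrite ler_wpM2r ?invr_ge0 ?(ltW gn0) // /V (bigD1 q) //= lerDl.
    by apply: sumr_ge0 => l _; exact: sqr_ge0.
  have := indicator_chebyshev (class_size R z q) g0 (ag q) n0.
  by rewrite hq.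
rewrite prod_meanD prod_mean_cst // prod_meanZr /V prod_mean_sum.
apply: (@le_trans _ _ (2 * n%:R ^+ 3 / (delta * n%:R) ^+ 4 +
   (\sum_(q < Q) n%:R) / (gamma / 2 * n%:R) ^+ 2)).
  rewrite lerD2l ler_wpM2r ?invr_ge0 ?exprn_ge0 ?mulr_ge0 ?divr_ge0 ?(ltW g0) //.
  by apply: ler_sum => q _; exact: class_size_variance.
rewrite sumr_const card_ord -mulr_natl le_eqVlt; apply/orP; left; apply/eqP.
by field; rewrite !gt_eqF.
Qed.

End Typical.

(** * Consistency *)

Section Deterministic.
Variables (R : realType) (Q : nat).

(** The distance [d0] is only known through its topology, in which the balls of
the entrywise norm are neighbourhoods of their centres. *)
Lemma switch_dist_near (d0 : 'M[R]_Q -> 'M[R]_Q -> R) (ps : 'M[R]_Q) (e : R) :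
  usual_distance d0 -> 0 < e ->
  exists2 kappa : R, 0 < kappa & forall p (s : 'S_Q),
    (forall k l, `|relabel s p k l - ps k l| < kappa) ->
    `|switch_dist d0 p ps| < e.
Proof.
move=> [d_eq d_sym d_tri d_nbhs] e0.
have d_ge0 u v : 0 <= d0 u v.
  have := d_tri u v u; rewrite (d_eq u u).2 // (d_sym v u); lra.
have /nbhs_ballP[k k0 hk] : nbhs ps [set p | d0 ps p < e].
  by apply/(d_nbhs _ _).2; exists e.
exists k => // p s hs.
rewrite ger0_norm; last by apply: le_bigmin => // s' _.
apply: (@le_lt_trans _ _ (d0 (relabel s p) ps)); first exact: bigmin_le.
by rewrite d_sym; apply: hk; split=> // i j; rewrite /ball /= distrC; exact: hs.
Qed.

Lemma entry_gap (ps : 'M[R]_Q) : exists2 kappa : R, 0 < kappa &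
  forall q l q' l', ps q l != ps q' l' -> 2 * kappa <= `|ps q l - ps q' l'|.
Proof.
pose g (k : ('I_Q * 'I_Q) * ('I_Q * 'I_Q)) := `|ps k.1.1 k.1.2 - ps k.2.1 k.2.2|.
pose m := \big[Num.min/1]_(k | g k != 0) g k.
have m0 : 0 < m.
  rewrite /m; apply: (big_ind (fun x => 0 < x)) => //.
    by move=> x y x0 y0; rewrite lt_min x0.
  by move=> k gk; rewrite lt_neqAle eq_sym gk normr_ge0.
exists (m / 2); first by rewrite divr_gt0.
move=> q l q' l' neq; rewrite mulrC divfK //.
apply: (bigmin_le_cond _ _ (j := ((q, l), (q', l')))).
by rewrite /g /= normr_eq0 subr_eq0.
Qed.

End Deterministic.

Section Consistency.
Variables (R : realType) (Q : nat) (zeta gamma : R).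
Hypotheses (zeta_gt0 : 0 < zeta) (gamma_gt0 : 0 < gamma).
Variables (a : 'rV[R]_Q) (ps : 'M[R]_Q).
Hypothesis adm : admissible zeta gamma a ps.

(** A purely deterministic statement: [eta] is chosen first, to absorb the
smoothing error, then [delta], to absorb the noise (whose coefficients [K] grow
as [eta] decreases), and finally the threshold on [n], to absorb the terms
linear in [n]. *)
Lemma argmax_consistent_on_typical (kappa : R) : 0 < kappa ->
  exists2 delta : R, 0 < delta & exists N : nat, forall n (z : {ffun 'I_n -> 'I_Q})
    (f : {ffun 'I_n * 'I_n -> bool}) a' p', (N <= n)%N ->
    typical ps delta gamma z f ->
    is_variational_argmax zeta gamma (mx_of f) a' p' ->
    exists s : 'S_Q, forall k l, `|relabel s p' k l - ps k l| < kappa.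
Proof.
move=> k0; have [[a01 a_sum ps01] psA1 psA2 ag] := adm.
have Q_gt0 : (0 < Q)%N.
  rewrite lt0n; apply: contra_eq_neq a_sum => Q0.
  rewrite big1 1?eq_sym ?oner_neq0 // => q _.
  by have := ltn_ord q; rewrite [X in (_ < X)%N]Q0.
have Q0 : 0 < Q%:R :> R by rewrite ltr0n.
have [kappa0 kappa0_gt0 gap] := entry_gap ps.
pose kap := Num.min kappa kappa0.
have kap0 : 0 < kap by rewrite lt_min k0.
(* The mismatch per squared node count that the relabelling tolerates: the overlap
   of a class is at least gamma / 2 / Q * n. It is spent in quarters below. *)
pose rho := (kap * (gamma / 2 / Q%:R)) ^+ 2.
have rho0 : 0 < rho by rewrite exprn_gt0 // mulr_gt0 // !divr_gt0.
pose eta := Num.min 1 (rho / 192).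
have eta0 : 0 < eta by rewrite lt_min ltr01 divr_gt0.
have eta1 : 0 < eta <= 1 by rewrite eta0 ge_min lexx.
have eta_rho : 48 * eta <= rho / 4.
  have : eta <= rho / 192 by rewrite ge_min lexx orbT.
  lra.
pose K := 2 * (1 + `|ln zeta| + `|ln eta|).
have K0 : 0 < K by rewrite mulr_gt0 // -addrA ltr_pwDl // addr_ge0.
pose delta := rho / (128 * Q%:R ^+ 2 * K).
have delta0 : 0 < delta by rewrite divr_gt0 // !mulr_gt0.
pose C := `|ln gamma| + Q%:R + 1.
pose N := (Num.bound (4 * (16 * C + 1) / rho)).+2.
exists delta => //; exists N => n z f a' p' Nn /and3P[hE /forallP hclass /forallP hposs] hmax.
have n_gt1 : (1 < n)%N by apply: leq_trans Nn.
have n0 : 0 < n%:R :> R by rewrite ltr0n ltnW.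
have C0 : 0 <= C by rewrite !addr_ge0.
have bound_lt : 4 * (16 * C + 1) / rho < n%:R.
  have x0 : 0 <= 4 * (16 * C + 1) / rho by rewrite divr_ge0 ?(ltW rho0) //; lra.
  apply: lt_le_trans (archi_boundP x0) _.
  by rewrite ler_nat; exact: leq_trans (leqW (leqnSn _)) Nn.
have large_n : (16 * C + 1) * n%:R < rho / 4 * n%:R ^+ 2.
  move: bound_lt; rewrite ltr_pdivrMr // => bound_lt.
  by rewrite expr2 mulrA ltr_pM2r //; lra.
have poss i j : i != j -> possible_edge (ps (z i) (z j)) (mx_of f i j).
  by move=> ij; rewrite mxE; move/forallP: (hposs i) => /(_ j) /implyP; apply.
have [t tV ht] := argmax_pair_loglik n_gt1 gamma_gt0 eta0 adm hmax poss.
have [[_ _ p'01] _ _ _] := hmax.1.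
have hK q l : `|ln (p' q l + eta) - ln (1 - p' q l + eta)| <= K.
  have := norm_ln_smooth eta1 (p'01 q l).
  have := @norm_ln_smooth R eta (1 - p' q l) eta1.
  have := ler_normB (ln (p' q l + eta)) (ln (1 - p' q l + eta)).
  have := p'01 q l; have := normr_ge0 (ln zeta); rewrite /K => h0 h1 h2 h3 h4.
  have := h3 ltac:(lra); lra.
have hKs q l : `|ln (ps q l + 0) - ln (1 - ps q l + 0)| <= K.
  rewrite !addr0.
  have h1 := @norm_ln_away R zeta (ps q l) zeta_gt0 (ps01 q l) (psA2 q l).
  have h2 := @norm_ln_away R zeta (1 - ps q l) zeta_gt0.
  have := ler_normB (ln (ps q l)) (ln (1 - ps q l)).
  have := normr_ge0 (ln eta); rewrite /K => h0 h3.
  have := ps01 q l => h4.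
  have h5 : `|ln (1 - ps q l)| <= `|ln zeta|.
    apply: h2 => [|h]; first by lra.
    have := psA2 q l ltac:(lra); lra.
  lra.
have hE' : gram_energy (noise_mx ps z (fun i j => mx_of f i j)) <= (delta * n%:R) ^+ 4.
  rewrite (_ : noise_mx _ _ _ = noise_mx ps z (fun i j => f (i, j))) //.
  by apply/matrixP => i j; rewrite !mxE.
have hmis := mismatch_le ps01 (ltW delta0) eta1 hE' p'01 tV hK hKs ht.
pose m := gamma / 2 / Q%:R * n%:R.
have m0 : 0 < m by rewrite mulr_gt0 // !divr_gt0.
have hclass' k : m * Q%:R <= class_size R z k.
  by rewrite /m mulrAC divfK ?gt_eqF.
have [t01 t1] := tV.
have mis_lt : mismatch ps z t p' < (kap * m) ^+ 2.
  apply: le_lt_trans hmis _.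
  have -> : (kap * m) ^+ 2 = rho * n%:R ^+ 2 by rewrite /m /rho; ring.
  have -> : 32 * Q%:R ^+ 2 * K * delta = rho / 4.
    by rewrite /delta; field; rewrite !gt_eqF.
  have : (rho / 4 + 48 * eta) * n%:R ^+ 2 <= (rho / 2) * n%:R ^+ 2.
    by rewrite ler_wpM2r ?sqr_ge0 //; lra.
  have : 0 < rho * n%:R ^+ 2 by rewrite mulr_gt0 // exprn_gt0.
  rewrite /C in large_n *; lra.
have [s hs] := class_map_of_mismatch t01 t1 m0 hclass' kap0 mis_lt.
have gap' q l q' l' : ps q l != ps q' l' -> 2 * kap <= `|ps q l - ps q' l'|.
  move=> /gap; apply: le_trans; rewrite ler_pM2l // ge_min lexx orbT //.
have [s' hs'] := relabel_of_class_map psA1 gap' hs.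
by exists s' => k l; apply: lt_le_trans (hs' k l) _; rewrite ge_min lexx.
Qed.

End Consistency.

Lemma cvg_cst_div_nat (R : realType) (c : R) :
  (c / n%:R)%:E @[n --> \oo] --> (0 : \bar R)%E.
Proof.
apply: cvg_EFin; first exact: nearW.
rewrite -[X in _ --> X](mulr0 c); apply: cvgMl_tmp.
apply/gtr0_cvgV0; last exact: cvgr_idn.
by near=> n; rewrite ltr0n; near: n; exact: nbhs_infty_gt.
Unshelve. all: by end_near.
Qed.

(* The estimators are functions of the observed adjacency matrix. They are
   maximizers with probability tending to 1, which holds in particular when they
   are maximizers for all data. The latter cannot be required in general, as (A1)
   is not a closed condition: for Q = 2, zeta < 1/2 and the directed 3-cycle,
   the supremum of Jn over admissible parameters is not attained. *)
Theorem corollary4p3 (R : realType) (Q : nat) (zeta gamma : R)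
    (zeta_gt0 : 0 < zeta) (gamma_gt0 : 0 < gamma) (gamma_lt : gamma < Q%:R^-1)
    (d : measure_display) (T : measurableType d) (P : probability T R)
    (Z : nat -> T -> 'I_Q) (X : nat -> nat -> T -> bool)
    (alpha_star : 'rV[R]_Q) (pi_star : 'M[R]_Q)
    (star_adm : admissible zeta gamma alpha_star pi_star)
    (XZ_sbm : is_sbm P Z X alpha_star pi_star)
    (alpha_tilde : forall n : nat, 'M[bool]_n -> 'rV[R]_Q)
    (pi_tilde : forall n : nat, 'M[bool]_n -> 'M[R]_Q)
    (tilde_argmax :
       P [set w | is_variational_argmax zeta gamma (adjacency X n w)
                    (alpha_tilde n (adjacency X n w))
                    (pi_tilde n (adjacency X n w))]
         @[n --> \oo] --> (1 : \bar R)%E)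
    (d0 : 'M[R]_Q -> 'M[R]_Q -> R) (d0_dist : usual_distance d0) :
  cvg_in_probability P
    (fun n w => switch_dist d0 (pi_tilde n (adjacency X n w)) pi_star)
    (fun _ => 0).
Proof.
move=> e e0.
have [[a01 a_sum ps01] _ _ ag] := star_adm.
have [kappa kappa0 hkappa] := switch_dist_near pi_star d0_dist e0.
have [delta delta0 [N hN]] :=
  argmax_consistent_on_typical zeta_gt0 gamma_gt0 star_adm kappa0.
pose c := 2 / delta ^+ 4 + Q%:R * (4 / gamma ^+ 2).
pose M n := [set w | is_variational_argmax zeta gamma (adjacency X n w)
  (alpha_tilde n (adjacency X n w)) (pi_tilde n (adjacency X n w))].
apply: (@squeeze_cvge _ _ _ _ (fun=> 0%E) _ (fun n => 1 - P (M n) + (c / n%:R)%:E)%E).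
- near=> n; rewrite measure_ge0 /=.
  (* All events at stake depend on the finite sample only, hence are measurable. *)
  have mB (B : {ffun 'I_n -> 'I_Q} -> {ffun 'I_n * 'I_n -> bool} -> bool) :=
    measurable_sample_event XZ_sbm B.
  have mM (C : 'M[bool]_n -> Prop) : measurable [set w | C (adjacency X n w)].
    rewrite (_ : [set w | _] = [set w | (fun _ f => `[< C (mx_of f) >])
        (labels Z n w) (edges X n w)]); first exact: (mB (fun _ f => `[< C (mx_of f) >])).
    by apply/seteqP; split=> w /=; rewrite adjacencyE => /asboolP.
  pose G := [set w | ~~ typical pi_star delta gamma (labels Z n w) (edges X n w)].
  have mG : measurable G := mB (fun z f => ~~ typical pi_star delta gamma z f).
  have mMn : measurable (M n) := mM (fun x => is_variational_argmax zeta gamma x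
    (alpha_tilde n x) (pi_tilde n x)).
  apply: (@le_trans _ _ (P (~` M n `|` G))).
    apply: le_measure; rewrite ?inE.
    + exact: (mM (fun x => e <= `|switch_dist d0 (pi_tilde n x) pi_star - 0|)).
    + by apply: measurableU => //; exact: measurableC.
    + move=> w /= he; apply: contrapT => /not_orP[/contrapT Mw /negP/negPn Gw].
      have Nn : (N <= n)%N by near: n; exact: nbhs_infty_ge.
      move: Mw; rewrite /M /= adjacencyE => Mw.
      have [s hs] := hN n _ _ _ _ Nn Gw Mw.
      have := hkappa _ s hs; rewrite -adjacencyE.
      by move: he; rewrite subr0 leNgt => /negbTE ->.
  apply: le_trans (measureU2 _ _ mG) _; first exact: measurableC.
  apply: leeD; first by rewrite -probability_setC.
  apply: le_trans (sample_event_prob_le XZ_sbm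
      (fun z f => ~~ typical pi_star delta gamma z f) _ ps01) _.
    by move=> q; have /andP[/ltW] := a01 q.
  rewrite lee_fin; apply: atypical_mean_le => //.
    by near: n; exact: nbhs_infty_gt.
  by move=> q; have /andP[] := ag q.
- exact: cvg_cst.
- rewrite -[X in _ --> X]adde0; apply: cvgeD => //; last exact: cvg_cst_div_nat.
  rewrite -[X in _ --> X](@subee _ 1%E) //; apply: cvgeB => //; exact: cvg_cst.
Unshelve. all: by end_near.
Qed.
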